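(* Let $A\in\mathbb{R}^{n\times n}$ and suppose that the set $\Lambda_1$ of rightmost eigenvalues of $A$ is single real or single complex. Let $y_0\in\mathbb{R}^n$ and $\widehat z_0\in\mathbb{R}^n$ with $\|\widehat z_0\|=1$, $w^{(1)}y_0\neq 0$ and $w^{(1)}\widehat z_0\neq 0$, and put $\widehat y_0:=y_0/\|y_0\|$. Then, for all $t\in\mathbb{R}$, $$K_\infty(t,y_0,\widehat z_0)=\frac{|\widehat w^{(1)}\widehat z_0|}{|\widehat w^{(1)}\widehat y_0|}\cdot\frac{g_1(t,\widehat z_0)}{g_1(t,\widehat y_0)}$$ and $$K_\infty(t,y_0)=\frac{1}{|\widehat w^{(1)}\widehat y_0|}\cdot\frac{g_1(t)}{g_1(t,\widehat y_0)}.$$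
   Context: $\|\cdot\|$ is an arbitrary norm on $\mathbb{C}^n$ (also used on $\mathbb{R}^n$ by restriction). For a real matrix $B\in\mathbb{R}^{n\times n}$, $\|B\|:=\max_{u\in\mathbb{R}^n,\|u\|=1}\|Bu\|$ (real induced norm). For a real row vector $b$, $\|b\|:=\max_{u\in\mathbb{R}^n,\|u\|=1}|bu|$; for a complex row vector $b$, $\|b\|:=\max_{u\in\mathbb{C}^n,\|u\|=1}|bu|$. The spectrum of $A$ is partitioned by real parts into $\Lambda_1,\dots,\Lambda_q$, where $\Lambda_j$ contains all eigenvalues with real part $r_j$ and $r_1>\dots>r_q$. $\Lambda_j$ is single real if it consists of one real eigenvalue $\lambda_j$ having exactly one Jordan block of maximum order; it is single complex if it consists of a complex conjugate pair $\lambda_j,\overline{\lambda_j}$ of non-real eigenvalues, each having exactly one Jordan block of maximum order, where $\lambda_j$ has positive imaginary part $\omega_j>0$. Let $V$ be an invertible matrix whose columns form a Jordan basis for $A$ and $W=V^{-1}$. Let $v^{(j,1)},\dots,v^{(j,M_j)}$ (columns of $V$) be the unique longest Jordan chain for $\lambda_j$, with $v^{(j,1)}$ an eigenvector; put $v^{(j)}:=v^{(j,1)}$, and let $w^{(j)}$ be the row of $W$ whose index equals the column index of $v^{(j,M_j)}$ in $V$. The Jordan basis is chosen so that $v^{(j)},w^{(j)}$ are real if $\Lambda_j$ is single real, and, if $\Lambda_j$ is single complex, $\overline{v^{(j,1)}},\dots,\overline{v^{(j,M_j)}}$ is the longest Jordan chain for $\overline{\lambda_j}$ in the basis and the row of $W$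 corresponding to $\overline{v^{(j,M_j)}}$ is $\overline{w^{(j)}}$. Put $\widehat v^{(j)}:=v^{(j)}/\|v^{(j)}\|$, $\widehat w^{(j)}:=w^{(j)}/\|w^{(j)}\|$, $f_j:=\|w^{(j)}\|\,\|v^{(j)}\|$, where $\|w^{(j)}\|$ is the real induced norm in the single real case and the complex induced norm in the single complex case. Define $Q_j(t)=v^{(j)}w^{(j)}$ if $\Lambda_j$ is single real and $Q_j(t)=2\,\mathrm{Re}(\mathrm{e}^{\mathrm{i}\omega_jt}v^{(j)}w^{(j)})$ (entrywise real part) if $\Lambda_j$ is single complex. For $u\in\mathbb{R}^n$ with $\widehat w^{(j)}u\neq0$, the numbers $g_j(t,u)$ and $g_j(t)$ are defined by $\|Q_j(t)u\|=f_j|\widehat w^{(j)}u|\,g_j(t,u)$ and $\|Q_j(t)\|=f_j\,g_j(t)$. The asymptotic condition numbers are $K_\infty(t,y_0,\widehat z_0):=\|Q_1(t)\widehat z_0\|/\|Q_1(t)\widehat y_0\|$ and $K_\infty(t,y_0):=\|Q_1(t)\|/\|Q_1(t)\widehat y_0\|$. *)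

(* Defs.v *)
From HB Require Import structures.
From mathcomp Require Import all_boot all_order all_algebra.
From mathcomp Require Import all_classical all_reals all_analysis.
From mathcomp Require Import complex.

Set Implicit Arguments.
Unset Strict Implicit.
Unset Printing Implicit Defensive.

Import Order.TTheory GRing.Theory Num.Theory.

Local Open Scope classical_set_scope.
Local Open Scope ring_scope.
Local Open Scope complex_scope.

Definition expi (R : realType) (x : R) : R[i] := cos x +i* sin x.

(* The canonical norm `|z| on R[i] takes its values in R[i]; [cabs] is the
   modulus as an element of R. *)
Definition cabs (R : realType) (z : R[i]) : R := Normc.normc z.

Definition toC (R : realType) (m n : nat) (B : 'M[R]_(m, n)) : 'M[R[i]]_(m, n) :=
  map_mx (real_complex R) B.

Definition conjm (R : realType) (m n : nat) (B : 'M[R[i]]_(m, n)) :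
  'M[R[i]]_(m, n) := map_mx (@conjc R) B.

Definition Rem (R : realType) (m n : nat) (B : 'M[R[i]]_(m, n)) : 'M[R]_(m, n) :=
  map_mx (@complex.Re R) B.

(* The scalar b u, for a row b and a column u. *)
Definition rowapp (R : realType) (n : nat) (b : 'rV[R[i]]_n) (u : 'cV[R[i]]_n) :
  R[i] := (b *m u) 0 0.

(* Nonnegativity of [N] follows from these axioms. *)
Definition is_norm (R : realType) (n : nat) (N : 'cV[R[i]]_n -> R) : Prop :=
  [/\ forall x y, N (x + y) <= N x + N y,
      forall (a : R[i]) x, N (a *: x) = cabs a * N x
    & forall x, N x = 0 -> x = 0].

Definition rnorm (R : realType) (n : nat) (N : 'cV[R[i]]_n -> R)
  (u : 'cV[R]_n) : R := N (toC u).

(* In the next three definitions the supremum is a maximum when n > 0, because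
   the unit sphere of a norm is then nonempty and compact. *)
Definition opnorm (R : realType) (n : nat) (N : 'cV[R[i]]_n -> R)
  (B : 'M[R]_n) : R :=
  sup [set rnorm N (B *m u) | u in [set u : 'cV[R]_n | rnorm N u = 1]].

(* Real induced norm of a row; it is meant for rows with real entries, which
   are typed here as rows over R[i]. *)
Definition rownormR (R : realType) (n : nat) (N : 'cV[R[i]]_n -> R)
  (b : 'rV[R[i]]_n) : R :=
  sup [set cabs (rowapp b (toC u)) | u in [set u : 'cV[R]_n | rnorm N u = 1]].

Definition rownormC (R : realType) (n : nat) (N : 'cV[R[i]]_n -> R)
  (b : 'rV[R[i]]_n) : R :=
  sup [set cabs (rowapp b u) | u in [set u : 'cV[R[i]]_n | N u = 1]].

(* A Jordan chain made of columns of a matrix V: its eigenvalue and the column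
   indices of its vectors v^(1), ..., v^(M), with v^(1) the eigenvector.  The
   index of v^(1) is kept apart, since a chain is nonempty. *)
Record jordan_chain (R : realType) (n : nat) := JordanChain {
  chain_val : R[i];
  chain_head : 'I_n;
  chain_tail : seq 'I_n
}.

Definition chain_idx (R : realType) (n : nat) (c : jordan_chain R n) : seq 'I_n :=
  chain_head c :: chain_tail c.

Definition chain_last (R : realType) (n : nat) (c : jordan_chain R n) : 'I_n :=
  last (chain_head c) (chain_tail c).

Definition is_jordan_chain (R : realType) (n : nat) (A V : 'M[R[i]]_n)
    (c : jordan_chain R n) : Prop :=
  A *m col (chain_head c) V = chain_val c *: col (chain_head c) V /\
  path (fun i j => A *m col j V == chain_val c *: col j V + col i V)
       (chain_head c) (chain_tail c).

(* The columns of V form a Jordan basis for A, partitioned into the chains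
   [c k], one for each Jordan block of A.  The order of the columns in V is
   arbitrary. *)
Definition is_jordan_basis (R : realType) (n : nat) (A V : 'M[R[i]]_n) (m : nat)
    (c : 'I_m -> jordan_chain R n) : Prop :=
  [/\ V \in unitmx,
      perm_eq (flatten [seq chain_idx (c k) | k <- enum 'I_m]) (enum 'I_n)
    & forall k, is_jordan_chain A V (c k)].

Definition unique_longest (R : realType) (n m : nat) (c : 'I_m -> jordan_chain R n)
    (l : R[i]) (k : 'I_m) : Prop :=
  chain_val (c k) = l /\
  forall k', chain_val (c k') = l -> k' != k ->
    (size (chain_idx (c k')) < size (chain_idx (c k)))%N.

Definition one_max_block (R : realType) (n m : nat) (c : 'I_m -> jordan_chain R n)
    (l : R[i]) : Prop :=
  exists k, unique_longest c l k.

(* [eigenvalue] is defined with row eigenvectors; the eigenvalues are the same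
   as with column eigenvectors. *)
Definition rightmost (R : realType) (n : nat) (A : 'M[R]_n) : set R[i] :=
  [set l | eigenvalue (toC A) l /\
     forall l', eigenvalue (toC A) l' -> complex.Re l' <= complex.Re l].

Variant single_kind := SingleReal | SingleComplex.

(* [L] is single real (resp. single complex), with l the eigenvalue in L (resp.
   the eigenvalue in L with positive imaginary part). *)
Definition single (R : realType) (n m : nat) (s : single_kind)
    (c : 'I_m -> jordan_chain R n) (L : set R[i]) (l : R[i]) : Prop :=
  match s with
  | SingleReal => [/\ L = [set l], complex.Im l = 0 & one_max_block c l]
  | SingleComplex =>
      [/\ L = [set l; l^*], 0 < complex.Im l,
          one_max_block c l & one_max_block c l^*]
  end.

Definition vvec (R : realType) (n : nat) (V : 'M[R[i]]_n) (c : jordan_chain R n) :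
  'cV[R[i]]_n := col (chain_head c) V.

Definition wvec (R : realType) (n : nat) (V : 'M[R[i]]_n) (c : jordan_chain R n) :
  'rV[R[i]]_n := row (chain_last c) (invmx V).

(* Compatibility of the Jordan basis with complex conjugation, for an eigenvalue
   l whose unique longest chain is [c k]. *)
Definition conj_adapted (R : realType) (n m : nat) (s : single_kind)
    (V : 'M[R[i]]_n) (c : 'I_m -> jordan_chain R n) (l : R[i]) (k : 'I_m) : Prop :=
  match s with
  | SingleReal =>
      conjm (vvec V (c k)) = vvec V (c k) /\ conjm (wvec V (c k)) = wvec V (c k)
  | SingleComplex =>
      forall k', unique_longest c l^* k' ->
        [seq col i V | i <- chain_idx (c k')]
          = [seq conjm (col i V) | i <- chain_idx (c k)] /\
        wvec V (c k') = conjm (wvec V (c k))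
  end.

Definition wnorm (R : realType) (n : nat) (s : single_kind)
    (N : 'cV[R[i]]_n -> R) (w : 'rV[R[i]]_n) : R :=
  match s with
  | SingleReal => rownormR N w
  | SingleComplex => rownormC N w
  end.

Definition what (R : realType) (n : nat) (s : single_kind)
    (N : 'cV[R[i]]_n -> R) (w : 'rV[R[i]]_n) : 'rV[R[i]]_n :=
  ((wnorm s N w)^-1)%:C *: w.

Definition fcoef (R : realType) (n : nat) (s : single_kind)
    (N : 'cV[R[i]]_n -> R) (v : 'cV[R[i]]_n) (w : 'rV[R[i]]_n) : R :=
  wnorm s N w * N v.

(* In the single real case v *m w has real entries, and [Rem] only changes its
   type. *)
Definition Qmx (R : realType) (n : nat) (s : single_kind) (omega : R)
    (v : 'cV[R[i]]_n) (w : 'rV[R[i]]_n) (t : R) : 'M[R]_n :=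
  match s with
  | SingleReal => Rem (v *m w)
  | SingleComplex => 2 *: Rem (expi (omega * t) *: (v *m w))
  end.

Definition normalize (R : realType) (n : nat) (N : 'cV[R[i]]_n -> R)
  (y : 'cV[R]_n) : 'cV[R]_n := (rnorm N y)^-1 *: y.

Definition Kinf_dir (R : realType) (n : nat) (N : 'cV[R[i]]_n -> R)
    (Q : R -> 'M[R]_n) (t : R) (y0 z0h : 'cV[R]_n) : R :=
  rnorm N (Q t *m z0h) / rnorm N (Q t *m normalize N y0).

Definition Kinf (R : realType) (n : nat) (N : 'cV[R[i]]_n -> R)
    (Q : R -> 'M[R]_n) (t : R) (y0 : 'cV[R]_n) : R :=
  opnorm N (Q t) / rnorm N (Q t *m normalize N y0).

(* Main.v *)
(* Substituting the defining relations of g_1 into the quotients makes f_1 cancel,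
   so what needs proof is that f_1 and w^(1) have nonzero norms.  As [wnorm] is a
   supremum, and [sup] of an unbounded set is 0, this requires u |-> w u to be
   bounded on the unit sphere of an arbitrary norm N of C^n: viewed on R^(2n), N is
   continuous and hence attains a positive minimum on the compact sup-norm
   sphere, so N dominates the sup norm. *)
Require Import Defs.
From HB Require Import structures.
From mathcomp Require Import all_boot all_order all_algebra.
From mathcomp Require Import all_classical all_reals all_analysis.
From mathcomp Require Import complex.

Set Implicit Arguments.
Unset Strict Implicit.
Unset Printing Implicit Defensive.

Import Order.TTheory GRing.Theory Num.Theory.
Import numFieldNormedType.Exports.

Local Open Scope ring_scope.

Section RealNormEquivalence.
Local Open Scope classical_set_scope.
Variables (R : realType) (k : nat) (p : 'rV[R]_k -> R).
Hypothesis pD : forall x y, p (x + y) <= p x + p y.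
Hypothesis pZ : forall a x, p (a *: x) = `|a| * p x.

(** Subadditivity at x and -x gives 0 = p(0) <= 2 p(x). *)
Lemma seminorm_ge0 x : 0 <= p x.
Proof.
have := pD x (- x); rewrite subrr -(scale0r x) -scaleN1r !pZ normrN1 normr0.
by rewrite mul0r mul1r -mulr2n pmulrn_lge0.
Qed.

Lemma coord_le_mx_norm (x : 'rV[R]_k) i : `|x 0 i| <= `|x|.
Proof.
rewrite [leRHS]/Num.norm /= mx_normrE; apply/bigmax_geP; right => /=.
by exists (0, i).
Qed.

Lemma seminorm_le_mx_norm x : p x <= (\sum_i p (delta_mx 0 i)) * `|x|.
Proof.
rewrite {1}(row_sum_delta x) mulr_suml.
apply: (big_ind2 (fun y r => p y <= r)) => [|y r z s yr zs|i _].
- by rewrite -(scale0r 0) pZ normr0 mul0r.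
- exact: le_trans (pD _ _) (lerD yr zs).
- by rewrite pZ mulrC ler_wpM2l ?seminorm_ge0 ?coord_le_mx_norm.
Qed.

(** By the reverse triangle inequality and the expansion of x - y in the standard basis, p is
    Lipschitz for the sup norm. *)
Lemma seminorm_continuous : continuous p.
Proof.
move=> x; apply/(@cvgrPdist_lt _ _ _ (nbhs x)) => e e0.
set M := \sum_i p (delta_mx 0 i).
have M0 : 0 <= M by apply: sumr_ge0 => i _; exact: seminorm_ge0.
(* M may be 0, so the radius is e / (M + 1) rather than e / M. *)
have M1 : 0 < M + 1 by rewrite ltr_wpDl.
have d0 : 0 < e / (M + 1) by rewrite divr_gt0.
near=> y.
have pB u v : p u - p v <= p (u - v) by rewrite lerBlDr -{1}(subrK v u) pD.
have pxy : `|p x - p y| <= p (x - y).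
  rewrite ler_norml lerNl opprB pB andbT (le_trans (pB y x)) //.
  by rewrite -(opprB x y) -scaleN1r pZ normrN1 mul1r.
apply: (le_lt_trans pxy); apply: (le_lt_trans (seminorm_le_mx_norm _)).
apply: (@le_lt_trans _ _ ((M + 1) * `|x - y|)).
  by rewrite ler_wpM2r ?lerDl.
rewrite mulrC -ltr_pdivlMr //; near: y.
Unshelve. all: by end_near. Qed.

Lemma mx_norm_le_norm : (forall x, p x = 0 -> x = 0) ->
  exists C, forall x, `|x| <= C * p x.
Proof.
move=> p0.
(* The zero space has an empty unit sphere, on which no minimum exists; there C = 0 works. *)
have [[x0 x0N0]|allx0] := pselect (exists x : 'rV[R]_k, x != 0); last first.
  exists 0 => x; have [->|xN0] := eqVneq x 0; first by rewrite normr0 mul0r.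
  by case: allx0; exists x.
pose S : set 'rV[R]_k := [set x | `|x| = 1].
have norm_unit (x : 'rV[R]_k) : x != 0 -> S (`|x|^-1 *: x).
  move=> xN0; rewrite /S /= normrZ ger0_norm ?invr_ge0 //.
  by rewrite mulVf // normr_eq0.
have cS : compact S.
  apply: bounded_closed_compact.
    by exists 1; split => // M M1 x /= ->; exact: ltW.
  have -> : S = (fun x : 'rV[R]_k => `|x|) @^-1` [set 1] by [].
  apply: preimage_closed => [x _|]; first exact: norm_continuous.
  exact: closed_eq.
have [] := @EVT_min_rV R k p S _ cS.
- by exists (`|x0|^-1 *: x0); exact: norm_unit.
- by apply: continuous_subspaceT; exact: seminorm_continuous.
move=> u; rewrite inE => Su pu_min.
have pu0 : 0 < p u.
  rewrite lt0r seminorm_ge0 andbT; apply/eqP => /p0 u0.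
  by move: Su; rewrite /S /= u0 normr0 => /eqP; rewrite eq_sym oner_eq0.
(* Minimality of p(u), tested at x / |x|, reads p(u) |x| <= p(x). *)
exists (p u)^-1 => x.
have [->|xN0] := eqVneq x 0.
  by rewrite normr0 mulr_ge0 ?seminorm_ge0 // invr_ge0 ltW.
have := pu_min (`|x|^-1 *: x); rewrite inE => /(_ (norm_unit _ xN0)).
rewrite pZ ger0_norm ?invr_ge0 // mulrC ler_pdivlMr ?normr_gt0 // => pu_le.
by rewrite mulrC ler_pdivlMr // mulrC.
Qed.

End RealNormEquivalence.

Section ComplexNorm.
Local Open Scope complex_scope.
Variables (R : realType) (n : nat) (N : 'cV[R[i]]_n -> R).
Hypothesis N_norm : is_norm N.

Lemma cabs_ge0 (z : R[i]) : 0 <= cabs z.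
Proof. by case: z => a b; exact: sqrtr_ge0. Qed.

Lemma cabs_eq0 (z : R[i]) : (cabs z == 0) = (z == 0).
Proof.
by apply/eqP/eqP => [/Normc.eq0_normc//|->]; exact: Normc.normc0.
Qed.

Lemma cabs_real (a : R) : cabs a%:C = `|a|.
Proof. by rewrite /cabs /= expr0n /= addr0 sqrtr_sqr. Qed.

Lemma cabs_le_ReIm (z : R[i]) : cabs z <= `|complex.Re z| + `|complex.Im z|.
Proof.
case: z => a b; have -> : a +i* b = a%:C + (0 +i* b).
  by apply/eqP; rewrite eq_complex /= addr0 add0r !eqxx.
apply: le_trans (le_normcD _ _) _.
by rewrite /= expr0n /= !(addr0, add0r) !sqrtr_sqr.
Qed.

Lemma toCZ (a : R) m (u : 'cV[R]_m) : toC (a *: u) = a%:C *: toC u.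
Proof. by rewrite /toC map_mxZ. Qed.

(** Identifies R^(2n) with C^n, so that composing N with it gives a real norm to which the
    compactness argument applies. *)
Definition complexify (x : 'rV[R]_(n + n)) : 'cV[R[i]]_n :=
  \col_j (x 0 (lshift n j) +i* x 0 (rshift n j)).

Lemma is_norm_neq0 x : x != 0 -> N x != 0.
Proof. by have [_ _ N0] := N_norm; apply: contraNneq => /N0 ->. Qed.

Lemma rowapp_bounded (w : 'rV[R[i]]_n) :
  exists C, forall u, cabs (rowapp w u) <= C * N u.
Proof.
have [ND NZ N0] := N_norm.
have [||x px0|C xC] := @mx_norm_le_norm R (n + n) (N \o complexify).
- move=> x y /=; suff -> : complexify (x + y) = complexify x + complexify y.
    exact: ND.
  by apply/colP => j; rewrite !mxE.
- move=> a x /=; rewrite -cabs_real -NZ; congr N.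
  apply/colP => j; rewrite !mxE; apply/eqP.
  by rewrite eq_complex /= !mul0r subr0 addr0 !eqxx.
- move/colP: (N0 _ px0) => x0; apply/rowP => i; rewrite mxE.
  by case: (split_ordP i) => j ->; have := x0 j; rewrite !mxE => -[].
(* The factor 2 comes from |u_j| <= |Re u_j| + |Im u_j|, each term being at most C N(u). *)
exists ((\sum_j cabs (w 0 j)) * (2 * C)) => u.
pose x := row_mx (\row_j complex.Re (u j 0)) (\row_j complex.Im (u j 0)).
have ux : u = complexify x.
  apply/colP => j; rewrite mxE row_mxEl row_mxEr !mxE.
  by case: (u j 0).
have uC j : cabs (u j 0) <= 2 * C * N u.
  apply: (le_trans (cabs_le_ReIm _)).
  rewrite -mulrA mulr_natl mulr2n.
  have xN i : `|x 0 i| <= C * N u.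
    by rewrite ux; apply: le_trans (xC x); exact: coord_le_mx_norm.
  apply: lerD.
    by have := xN (lshift n j); rewrite row_mxEl mxE.
  by have := xN (rshift n j); rewrite row_mxEr mxE.
rewrite /rowapp mxE -mulrA mulr_suml.
apply: (big_ind2 (fun z r => cabs z <= r)) => [|y r z s yr zs|j _].
- by rewrite /cabs Normc.normc0.
- exact: le_trans (le_normcD _ _) (lerD yr zs).
- by rewrite /cabs Normc.normcM ler_wpM2l ?uC ?cabs_ge0.
Qed.

(** The set under the supremum is bounded by [rowapp_bounded], so its [sup] is at least |w u| > 0. A
    real unit vector u lies in both the real and the complex sphere, hence serves both kinds. *)
Lemma wnorm_gt0 s (w : 'rV[R[i]]_n) (u : 'cV[R]_n) :
  rnorm N u = 1 -> rowapp w (toC u) != 0 -> 0 < wnorm s N w.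
Proof.
move=> u1 wu0; have [C wC] := rowapp_bounded w.
have wu_gt0 : 0 < cabs (rowapp w (toC u)) by rewrite lt0r cabs_eq0 wu0 cabs_ge0.
apply: (lt_le_trans wu_gt0); case: s => /=.
- apply: ub_le_sup; last by exists u.
  exists C => _ [x /= x1 <-].
  by rewrite (le_trans (wC _)) // -/(rnorm N x) x1 mulr1.
- apply: ub_le_sup; last by exists (toC u).
  by exists C => _ [x /= x1 <-]; rewrite (le_trans (wC _)) // x1 mulr1.
Qed.

Lemma rowapp_what_neq0 s (w : 'rV[R[i]]_n) (u : 'cV[R[i]]_n) :
  wnorm s N w != 0 -> rowapp w u != 0 -> rowapp (what s N w) u != 0.
Proof.
move=> w0 wu0; rewrite /rowapp /what -scalemxAl mxE mulf_neq0 //.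
by rewrite -cabs_eq0 cabs_real normr_eq0 invr_eq0.
Qed.

End ComplexNorm.

(** A zero column j of V would make column j of V^-1 V = 1 vanish, although its diagonal entry is
    1. *)
Lemma col_unitmx_neq0 (F : fieldType) n (V : 'M[F]_n) j :
  V \in unitmx -> col j V != 0.
Proof.
move=> Vu; apply/eqP => Vj0.
have : col j (1%:M : 'M[F]_n) = 0 by rewrite colE -(mulVmx Vu) -mulmxA -colE Vj0 mulmx0.
by move/colP => /(_ j) /eqP; rewrite !mxE eqxx oner_eq0.
Qed.

Theorem theorem17 (R : realType) (n : nat)
    (N : 'cV[R[i]]_n -> R) (N_norm : is_norm N)
    (A : 'M[R]_n)
    (V : 'M[R[i]]_n) (m : nat) (c : 'I_m -> jordan_chain R n)
    (V_jordan : is_jordan_basis (toC A) V c)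
    (s : single_kind) (l1 : R[i]) (L1_single : single s c (rightmost A) l1)
    (k1 : 'I_m) (k1_longest : unique_longest c l1 k1)
    (V_conj : conj_adapted s V c l1 k1) :
  let v := vvec V (c k1) in
  let w := wvec V (c k1) in
  let wh := what s N w in
  let f := fcoef s N v w in
  let Q := Qmx s (complex.Im l1) v w in
  forall (g : R -> 'cV[R]_n -> R)
    (g_def : forall t u, rowapp wh (toC u) != 0 ->
       rnorm N (Q t *m u) = f * cabs (rowapp wh (toC u)) * g t u)
    (gop : R -> R)
    (gop_def : forall t, opnorm N (Q t) = f * gop t)
    (y0 z0h : 'cV[R]_n),
  rnorm N z0h = 1 ->
  rowapp w (toC y0) != 0 ->
  rowapp w (toC z0h) != 0 ->
  let y0h := normalize N y0 in
  forall t : R,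
    Kinf_dir N Q t y0 z0h
      = cabs (rowapp wh (toC z0h)) / cabs (rowapp wh (toC y0h))
          * (g t z0h / g t y0h) /\
    Kinf N Q t y0 = (cabs (rowapp wh (toC y0h)))^-1 * (gop t / g t y0h).
Proof.
move=> v w wh f Q g g_def gop gop_def y0 z0h z1 wy0 wz0 y0h t.
have wn0 : wnorm s N w != 0 by rewrite gt_eqF // (wnorm_gt0 N_norm s z1 wz0).
have f0 : f != 0.
  apply: mulf_neq0 => //; apply: is_norm_neq0 => //.
  by apply: col_unitmx_neq0; case: V_jordan.
(* Since w y0 is nonzero, so is y0; hence [y0h] is a nonzero multiple of y0 and w does not vanish on
   it. *)
have Ny0 : rnorm N y0 != 0.
  apply: is_norm_neq0 => //; apply: contraNneq wy0 => ->.
  by rewrite /rowapp mulmx0 mxE.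
have wy0h : rowapp w (toC y0h) != 0.
  rewrite /rowapp toCZ -scalemxAr mxE mulf_neq0 //.
  by rewrite -cabs_eq0 cabs_real normr_eq0 invr_eq0.
have whz0 := rowapp_what_neq0 wn0 wz0.
have why0 := rowapp_what_neq0 wn0 wy0h.
(* Only f has to be cancelled. The regrouping by [mulf_div] and [invfM] is valid with the convention
   x / 0 = 0, so no case distinction is made on whether [g t y0h] vanishes. *)
rewrite /Kinf_dir /Kinf -/y0h !g_def // gop_def; split.
  by rewrite -[LHS]mulf_div -[X in X * _ = _]mulf_div divff // mul1r.
by rewrite -[LHS]mulf_div invfM mulVKf.
Qed.
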